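(* Let $\Gamma=(V,E)$ be a graph such that its complement $\Gamma^C$ is reduced, and let $\pi_0\in\mathrm{Aut}^{\tau}(\Gamma)$. Then for every integer $r\ge1$ and every $v\in V$, $$\pi_0(B(v,r)) = B(\gamma^{r}(\pi_0)(v),r),$$ where $\gamma$ is the map defined for $\mathrm{Aut}^{\pi}(\Gamma^C)$ and $\gamma^r$ denotes its $r$-fold iterate.
   Context: Graphs are finite, simple, loopless. $d(v,w)$ is the shortest-path distance in $\Gamma$ ($\infty$ if no path); $B(v,r)=\{w\in V: d(v,w)\le r\}$. $\mathrm{Aut}^{\tau}(\Gamma)$ is the group of bijections $\pi$ of $V$ such that for every $v$ there is $w$ with $\pi(B(v,1))=B(w,1)$. $\Gamma^C$ is the complement of $\Gamma$ (same vertices, $v\neq w$ adjacent iff not adjacent in $\Gamma$); reduced means distinct vertices have distinct neighbourhoods. For a reduced graph $\Delta$, $\mathrm{Aut}^{\pi}(\Delta)$ is the group of bijections $\pi$ of $V$ such that each $\pi(N_\Delta(v))$ equals some $N_\Delta(w)$, and $\gamma(\pi)$ is the permutation with $N_\Delta(\gamma(\pi)(v))=\pi(N_\Delta(v))$. One has $\mathrm{Aut}^{\tau}(\Gamma)=\mathrm{Aut}^{\pi}(\Gamma^C)$ when $\Gamma^C$ is reduced. *)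

(* Defs.v *)
From HB Require Import structures.
From mathcomp Require Import all_boot all_fingroup.

Set Implicit Arguments.
Unset Strict Implicit.
Unset Printing Implicit Defensive.

Record sgraph (V : finType) := SGraph {
  adj :> rel V;
  adj_sym : symmetric adj;
  adj_irr : irreflexive adj }.

Section Graph.

Variables (V : finType) (G : sgraph V).
Implicit Types (v w : V) (s t : {perm V}).

Definition nbhd v : {set V} := [set w | G v w].

Definition reduced : Prop := injective nbhd.

(* There is a path (no repeated vertex) with n edges from v to w. *)
Definition has_path v w (n : nat) : bool :=
  [exists p : n.-tuple V, [&& path G v p, uniq (v :: p) & last v p == w]].

Lemma connect_has_path v w : connect G v w -> exists n, has_path v w n.
Proof.
case/connectP=> p vp ->; case: (shortenP vp) => q vq uq _.
by exists (size q); apply/existsP; exists (in_tuple q); rewrite vq uq eqxx.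
Qed.

(* None stands for infinity. *)
Definition dist v w : option nat :=
  match @idP (connect G v w) with
  | ReflectT vw => Some (ex_minn (connect_has_path vw))
  | ReflectF _ => None
  end.

Definition ball v (r : nat) : {set V} :=
  [set w | if dist v w is Some n then n <= r else false].

Lemma distP v w n :
  dist v w = Some n <-> has_path v w n /\ forall m, has_path v w m -> n <= m.
Proof.
rewrite /dist; case: {-}_ / idP => [vw|nvw].
  case: ex_minnP => m vm m_min; split=> [[<-] //|[vn n_min]].
  by congr Some; apply/eqP; rewrite eqn_leq m_min // n_min.
split=> // -[/existsP[p /and3P[vp _ /eqP vpw]] _]; case: nvw.
by apply/connectP; exists p.
Qed.

Lemma in_ball v w r :
  (w \in ball v r) = [exists n : 'I_r.+1, has_path v w n].
Proof.
rewrite inE; case dvw: (dist v w) => [n|]; last first.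
  apply/esym/existsP=> -[n /existsP[p /and3P[vp _ /eqP vpw]]].
  move: dvw; rewrite /dist; case: {-}_ / idP => // -[].
  by apply/connectP; exists p.
have [vn n_min] := (distP v w n).1 dvw.
apply/idP/existsP=> [nr|[m vm]]; first by exists (Ordinal (nr : n < r.+1)).
by rewrite (leq_trans (n_min m vm)) // -ltnS.
Qed.

Definition aut_tau : {set {perm V}} :=
  [set s : {perm V} | [forall v, exists w, s @: ball v 1 == ball w 1]].

Lemma aut_tau_group_set : group_set aut_tau.
Proof.
apply/group_setP; split=> [|s t].
  rewrite inE; apply/forallP=> v; apply/existsP; exists v.
  by rewrite (eq_imset _ (@perm1 _)) imset_id.
rewrite !inE => /forallP sG /forallP tG; apply/forallP=> v.
have /existsP[w /eqP sv] := sG v; have /existsP[x tw] := tG w.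
by apply/existsP; exists x; rewrite (eq_imset _ (permM s t)) imset_comp sv.
Qed.
Canonical aut_tau_group := Group aut_tau_group_set.

Definition aut_pi : {set {perm V}} :=
  [set s : {perm V} | [forall v, exists w, s @: nbhd v == nbhd w]].

Lemma aut_pi_group_set : group_set aut_pi.
Proof.
apply/group_setP; split=> [|s t].
  rewrite inE; apply/forallP=> v; apply/existsP; exists v.
  by rewrite (eq_imset _ (@perm1 _)) imset_id.
rewrite !inE => /forallP sG /forallP tG; apply/forallP=> v.
have /existsP[w /eqP sv] := sG v; have /existsP[x tw] := tG w.
by apply/existsP; exists x; rewrite (eq_imset _ (permM s t)) imset_comp sv.
Qed.
Canonical aut_pi_group := Group aut_pi_group_set.

(* Total on {perm V}: the value 1 is only taken as a default outside aut_pi,   *)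
(* and for a reduced graph gamma maps aut_pi to itself, so that iterating it   *)
(* from an element of aut_pi never meets the default; see the lemmas below.    *)
Definition gamma s : {perm V} :=
  odflt 1%g [pick t : {perm V} | [forall v, nbhd (t v) == s @: nbhd v]].

Lemma gammaP s : reduced -> s \in aut_pi ->
  forall v, nbhd (gamma s v) = s @: nbhd v.
Proof.
move=> redG; rewrite inE => /forallP sG.
pose f v := xchoose (existsP (sG v)).
have fP v : nbhd (f v) = s @: nbhd v.
  exact/esym/eqP/(xchooseP (existsP (sG v))).
have f_inj : injective f.
  move=> v w fvw; apply: redG.
  by apply: (imset_inj (@perm_inj _ s)); rewrite -!fP fvw.
rewrite /gamma; case: pickP => [t /forallP tP v|/(_ (perm f_inj))/negP[]].
  by rewrite /= (eqP (tP v)).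
by apply/forallP=> v; rewrite permE fP.
Qed.

Lemma gamma_uniq s t : reduced -> s \in aut_pi ->
  (forall v, nbhd (t v) = s @: nbhd v) -> t = gamma s.
Proof.
by move=> redG sG tP; apply/permP=> v; apply: (redG); rewrite tP (gammaP redG sG).
Qed.

Lemma gamma_aut_pi s : reduced -> s \in aut_pi -> gamma s \in aut_pi.
Proof.
move=> redG sG; rewrite inE; apply/forallP=> v; apply/existsP; exists (s v).
apply/eqP/setP=> w; rewrite -[w](permKV (gamma s)) mem_imset; last exact: perm_inj.
move: ((gamma s)^-1%g w) => u; rewrite !inE adj_sym.
have -> : G (s v) (gamma s u) = (s v \in nbhd (gamma s u)) by rewrite inE adj_sym.
by rewrite (gammaP redG sG) mem_imset ?inE //; exact: perm_inj.
Qed.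

End Graph.

Section Complement.

Variables (V : finType) (G : sgraph V).

Definition compl_rel : rel V := fun v w => (v != w) && ~~ G v w.

Lemma compl_sym : symmetric compl_rel.
Proof. by move=> v w; rewrite /compl_rel eq_sym adj_sym. Qed.

Lemma compl_irr : irreflexive compl_rel.
Proof. by move=> v; rewrite /compl_rel eqxx. Qed.

Definition compl : sgraph V := SGraph compl_sym compl_irr.

Lemma ball1E (v : V) : ball G v 1 = ~: nbhd compl v.
Proof.
apply/setP=> w; rewrite in_ball !inE /= /compl_rel negb_and !negbK.
apply/existsP/orP=> [[[[|[|//]] /= _] /existsP[p]]|].
- by rewrite tuple0 /= => vw; left.
- by case/tupleP: p => x p; rewrite tuple0 /= => /and3P[vx _ /eqP <-];
    right; case/andP: vx.
case=> [/eqP <-|vw].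
  by exists ord0; apply/existsP; exists [tuple]; rewrite /= eqxx.
exists ord_max; apply/existsP; exists [tuple w]; rewrite /= vw eqxx !inE !andbT.
by apply: contraTneq vw => ->; rewrite adj_irr.
Qed.

Lemma aut_tau_compl : aut_tau G = aut_pi compl.
Proof.
apply/setP=> s; rewrite !inE; apply: eq_forallb => v; apply: eq_existsb => w.
rewrite !ball1E -(inj_eq (@setC_inj _)) setCK; congr (_ == _).
apply/setP=> x; rewrite -[x](permKV s) inE !mem_imset ?inE ?negbK //;
  exact: perm_inj.
Qed.

End Complement.

(* Main.v *)
(* Write B(v, r+1) as the union of the B(u, 1) over u in B(v, r). Since pi maps *)
(* B(u, 1) to B(gamma pi u, 1), the statement for pi at radius r+1 follows from  *)
(* the statement for gamma pi at radius r, and the induction starts at r = 0.    *)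
Require Import Defs.
From mathcomp Require Import all_boot all_fingroup.

Set Implicit Arguments.
Unset Strict Implicit.
Unset Printing Implicit Defensive.

(** A unit ball is the set complement of a neighbourhood in [compl G], so [gamma] tracks centres of
    unit balls ([imset_ball1]); [ballS] costs one [gamma] per unit of radius. *)

(** Allowing walks with repeated vertices lets them be cut and concatenated freely in [ballS]. *)
Lemma ballP (V : finType) (G : sgraph V) (v w : V) (r : nat) :
  reflect (exists p, [/\ path G v p, size p <= r & last v p = w])
          (w \in ball G v r).
Proof.
rewrite in_ball; apply: (iffP existsP) => [[n /existsP[p]]|[p [vp p_r <-]]].
  by case/and3P=> vp _ /eqP pw; exists p; rewrite size_tuple -ltnS.
case: (shortenP vp) => q vq uq q_p.
have q_r : size q < r.+1.
  by rewrite ltnS (leq_trans _ p_r) // uniq_leq_size //; case/andP: uq.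
by exists (Ordinal q_r); apply/existsP; exists (in_tuple q); rewrite vq uq /=.
Qed.

Lemma ball0 (V : finType) (G : sgraph V) (v : V) : ball G v 0 = [set v].
Proof.
apply/setP=> w; rewrite inE; apply/ballP/eqP=> [[p [_]]|->]; last first.
  by exists [::].
by rewrite leqn0 size_eq0 => /eqP -> <-.
Qed.

Lemma ballS (V : finType) (G : sgraph V) (v : V) (r : nat) :
  ball G v r.+1 = \bigcup_(u in ball G v r) ball G u 1.
Proof.
apply/setP=> w; apply/ballP/bigcupP=> [[p]|[_ /ballP[p [vp p_r <-]] /ballP[q]]].
  case/lastP: p => [|p x] [vp p_r <-].
    by exists v; apply/ballP; exists [::].
  move: vp p_r; rewrite rcons_path size_rcons last_rcons => /andP[vp px] p_r.
  exists (last v p); apply/ballP; first by exists p.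
  by exists [:: x]; rewrite /= px.
case=> pq q_1 <-; exists (p ++ q).
by rewrite cat_path vp size_cat last_cat -addn1 leq_add.
Qed.

(** A bijection commutes with set complement, so [gammaP] transfers through [ball1E]. *)
Lemma imset_ball1 (V : finType) (G : sgraph V) (s : {perm V}) (v : V) :
  reduced (compl G) -> s \in aut_pi (compl G) ->
  s @: ball G v 1 = ball G (gamma (compl G) s v) 1.
Proof.
move=> redG sG; rewrite !ball1E (gammaP redG sG).
apply/setP=> x; rewrite -[x](permKV s) inE.
by rewrite !(mem_imset _ _ (@perm_inj _ s)) inE.
Qed.

Theorem theorem4p2 (V : finType) (G : sgraph V) (pi0 : {perm V}) :
  reduced (compl G) -> pi0 \in aut_tau G ->
  forall (r : nat) (v : V), 1 <= r ->
    pi0 @: ball G v r = ball G (iter r (gamma (compl G)) pi0 v) r.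
Proof.
move=> redG; rewrite aut_tau_compl => piG r v _.
elim: r pi0 piG => [|r IHr] s sG; first by rewrite !ball0 imset_set1.
(* [iterSr] peels off the innermost [gamma], so the hypothesis is used at [gamma s], again in
   [aut_pi]. *)
rewrite !ballS iterSr -IHr ?gamma_aut_pi //.
(* Reindex the right-hand union along the injective [gamma s]. *)
rewrite big_imset /=; last by move=> x y _ _; apply: perm_inj.
rewrite (big_morph _ (imsetU _) (imset0 _)).
by apply: eq_bigr => u _; apply: imset_ball1.
Qed.
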